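(* Let $\mathbf{s}=(s_1,\ldots,s_r)$ be a query with $s_k(\mathbf{x})\in[c_{k0},c_{k1}]$ (finite bounds) for all data sets $\mathbf{x}$ and $k=1,\ldots,r$, and let the set of possible outputs be $\mathcal{S}=[c_{10},c_{11}]\times\cdots\times[c_{r0},c_{r1}]$. For a utility function $u(\mathbf{s}^*|\mathbf{x})$ on $\mathbf{s}^*\in\mathcal{S}$ let $\Delta_u=\max_{\mathbf{s}^*\in\mathcal{S},\,d(\mathbf{x},\mathbf{x}')=1}|u(\mathbf{s}^*|\mathbf{x})-u(\mathbf{s}^*|\mathbf{x}')|$. (a) When $u(\mathbf{s}^*|\mathbf{x})=-\|\mathbf{s}^*-\mathbf{s}(\mathbf{x})\|_1$, one has $\Delta_u\le\Delta_1$; moreover, for each $\epsilon>0$, both the truncated generalized Gaussian mechanism of order $1$ and the Exponential mechanism with this utility function (each at its smallest allowed scale) reduce to the truncated Laplace mechanism, with density on $\mathcal{S}$ proportional to $\prod_{k=1}^r\exp(-|s_k^*-s_k(\mathbf{x})|/b)$, with the same scale $b$, i.e. $2\epsilon^{-1}\Delta_u=2\epsilon^{-1}\Delta_1$. (b) When $u(\mathbf{s}^*|\mathbf{x})=-\|\mathbf{s}^*-\mathbf{s}(\mathbf{x})\|_2^2$, one has $\Delta_u\le2\sum_{k=1}^r\Delta_{1,k}|c_{k1}-c_{k0}|$. (c) When $u(\mathbf{s}^*|\mathbf{x})=-\|\mathbf{s}^*-\mathbf{s}(\mathbf{x})\|_p^p$ for an integer $p\ge3$, one has $$\Delta_u\le\sum_{k=1}^r\sum_{j=1}^p\binom{p}{j}\left(\max\{|c_{k0}|,|c_{k1}|\}\right)^{p-j}\Delta_{1,k}^{(j)},$$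 where $\Delta_{1,k}^{(j)}=\max_{d(\mathbf{x},\mathbf{x}')=1}|(s_k(\mathbf{x}))^j-(s_k(\mathbf{x}'))^j|$ is the $l_1$ global sensitivity of $(s_k)^j$.
   Context: $d(\mathbf{x},\mathbf{x}')=1$ is a symmetric neighboring relation on data sets (they differ by one individual). $\Delta_{1,k}=\max_{d(\mathbf{x},\mathbf{x}')=1}|s_k(\mathbf{x})-s_k(\mathbf{x}')|$ and $\Delta_1=\max_{d(\mathbf{x},\mathbf{x}')=1}\sum_{k=1}^r|s_k(\mathbf{x})-s_k(\mathbf{x}')|$ are $l_1$ global sensitivities (all maxima understood as suprema). The Exponential mechanism with utility $u$ and privacy budget $\epsilon$ releases $\mathbf{s}^*\in\mathcal{S}$ with density proportional to $\exp\left(u(\mathbf{s}^*|\mathbf{x})\,\epsilon/(2\Delta_u)\right)$ on $\mathcal{S}$; for $u=-\|\mathbf{s}^*-\mathbf{s}(\mathbf{x})\|_p^p$ this is the product of generalized Gaussian densities with scale $b$, $b^p=2\Delta_u\epsilon^{-1}$, restricted to $\mathcal{S}$. The truncated generalized Gaussian mechanism of order $p$ releases $\mathbf{s}^*\in\mathcal{S}$ with density proportional to $\prod_k\exp\{-(|s_k^*-s_k(\mathbf{x})|/b)^p\}$ on $\mathcal{S}$ with scale satisfying $b^p\ge2\epsilon^{-1}\left(\sum_{k=1}^r\sum_{j=1}^{p-1}\binom{p}{j}|c_{k1}-c_{k0}|^{p-j}\Delta_{1,k}^j+\Delta_p^p\right)$, where $\Delta_p$ is the $l_p$ global sensitivity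 of $\mathbf{s}$; for $p=1$ this is $b\ge2\epsilon^{-1}\Delta_1$. *)

(* Defs.v *)
From HB Require Import structures.
From mathcomp Require Import all_boot all_order all_algebra.
From mathcomp Require Import all_classical all_reals all_analysis.
Import Order.TTheory GRing.Theory Num.Theory.
Import numFieldNormedType.Exports.

Set Implicit Arguments.
Unset Strict Implicit.
Unset Printing Implicit Defensive.

Local Open Scope classical_set_scope.
Local Open Scope ring_scope.

(* R^n with its Borel sigma-algebra; measurableTypeR R is R itself, carrying
   the sigma-algebra on which lebesgue_measure is defined. *)
Notation rvec R n := (n.-tuple (measurableTypeR R)).

Definition entry (R : realType) (n : nat) (t : rvec R n) (k : 'I_n) : R :=
  tnth t k.

Section LebesgueStep.
Context (R : realType) (n : nat).
Variable mu : {sigma_finite_measure set (rvec R n) -> \bar R}.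

Definition cons_rvec (q : measurableTypeR R * rvec R n) : rvec R n.+1 :=
  [tuple of q.1 :: q.2].

Lemma measurable_cons_rvec : measurable_fun setT cons_rvec.
Proof. exact: measurable_cons. Qed.

Definition lebesgue_step : set (rvec R n.+1) -> \bar R :=
  pushforward (@lebesgue_measure R \x mu)%E cons_rvec.

Let lebesgue_step0 : lebesgue_step set0 = 0%E.
Proof. by rewrite /lebesgue_step /pushforward preimage_set0 measure0. Qed.

Let lebesgue_step_ge0 A : (0 <= lebesgue_step A)%E.
Proof. exact: (measure_ge0 (@lebesgue_measure R \x mu)%E). Qed.

Let lebesgue_step_sigma_additive : semi_sigma_additive lebesgue_step.
Proof.
have mpre B : measurable B -> measurable (cons_rvec @^-1` B).
  by move=> mB; rewrite -[X in measurable X]setTI; exact: measurable_cons_rvec.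
move=> F mF tF mUF; rewrite /lebesgue_step /pushforward preimage_bigcup.
apply: measure_semi_sigma_additive.
- by move=> k; exact: mpre.
- apply/trivIsetP => /= i j _ _ ij; rewrite -preimage_setI.
  by move/trivIsetP : tF => /(_ _ _ _ _ ij) ->//; rewrite preimage_set0.
- by rewrite -preimage_bigcup; exact: mpre.
Qed.

HB.instance Definition _ := isMeasure.Build _ _ _ lebesgue_step
  lebesgue_step0 lebesgue_step_ge0 lebesgue_step_sigma_additive.

Let lebesgue_step_sigma_finite : sigma_finite setT lebesgue_step.
Proof.
pose g (t : rvec R n.+1) : measurableTypeR R * rvec R n :=
  (tnth t ord0, [tuple of behead t]).
have mg : measurable_fun setT g.
  by apply: measurable_fun_pair; [exact: measurable_tnth|exact: measurable_behead].
have gK q : g (cons_rvec q) = q.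
  by case: q => x t; rewrite /g; congr (_, _); apply/val_inj.
have /sigma_finiteP[F [TF ndF Foo]] := sigma_finiteT (@lebesgue_measure R).
have /sigma_finiteP[G [TG ndG Goo]] := sigma_finiteT mu.
exists (fun k => g @^-1` (F k `*` G k)).
  rewrite -preimage_bigcup -[LHS](preimage_setT g); congr (g @^-1` _).
  rewrite -setXTT TF TG predeqE => -[x y]; split.
    move=> [/= [i _ Fix] [j _ Gjy]]; exists (maxn i j) => //; split.
    - by move: x Fix; exact/subsetPset/ndF/leq_maxl.
    - by move: y Gjy; exact/subsetPset/ndG/leq_maxr.
  by move=> [i _ [/= ? ?]]; split; exists i.
move=> k; have [mF Fk] := Foo k; have [mG Gk] := Goo k; split.
  by rewrite -[X in measurable X]setTI; apply: mg => //; exact: measurableX.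
rewrite /lebesgue_step /pushforward -comp_preimage.
rewrite (_ : g \o cons_rvec = idfun) ?preimage_id; last exact/funext.
by rewrite product_measure1E// lte_mul_pinfty// ge0_fin_numE.
Qed.

HB.instance Definition _ := Measure_isSigmaFinite.Build _ _ _ lebesgue_step
  lebesgue_step_sigma_finite.

End LebesgueStep.

(* Lebesgue measure on R^n: the n-fold product of lebesgue_measure. *)
Fixpoint lebesgue_tuple (R : realType) (n : nat) :
    {sigma_finite_measure set (rvec R n) -> \bar R} :=
  if n is m.+1 return {sigma_finite_measure set (rvec R n) -> \bar R}
  then lebesgue_step (lebesgue_tuple R m)
  else \d_([tuple] : rvec R 0).

(* Supremum of D over pairs of neighbors, for a nonnegative D; the value is 0 if
   there are no neighbors. *)
Definition sensitivity (R : realType) (X : Type) (nb : X -> X -> Prop)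
    (D : X -> X -> R) : R :=
  sup [set v | exists x x', nb x x' /\ v = D x x'].

Section Mechanisms.
Context (R : realType) (X : Type) (nb : X -> X -> Prop) (r : nat).
Variables (c0 c1 : 'I_r -> R) (s : X -> rvec R r).

Definition outputs : set (rvec R r) :=
  [set t | forall k, c0 k <= entry t k <= c1 k].

Definition lp_norm (p : nat) (v : 'I_r -> R) : R :=
  (\sum_(k < r) `|v k| ^+ p) `^ p%:R^-1.

Definition lp_dist (p : nat) (t t' : rvec R r) : R :=
  lp_norm p (fun k => entry t k - entry t' k).

Definition sens1_coord (k : 'I_r) : R :=
  sensitivity nb (fun x x' => `|entry (s x) k - entry (s x') k|).

Definition sens1_coord_pow (j : nat) (k : 'I_r) : R :=
  sensitivity nb (fun x x' => `|entry (s x) k ^+ j - entry (s x') k ^+ j|).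

Definition sens1 : R :=
  sensitivity nb (fun x x' => \sum_(k < r) `|entry (s x) k - entry (s x') k|).

Definition sens_lp (p : nat) : R :=
  sensitivity nb (fun x x' => lp_dist p (s x) (s x')).

Definition utility_sens (u : rvec R r -> X -> R) : R :=
  sup [set v | exists t x x',
    [/\ outputs t, nb x x' & v = `|u t x - u t x'|]].

Definition lp_utility (p : nat) (t : rvec R r) (x : X) : R :=
  - lp_dist p t (s x) ^+ p.

(* P has Lebesgue density proportional to h on S, and gives no mass to the
   complement of S. *)
Definition density_prop_to (h : rvec R r -> R)
    (P : probability (rvec R r) R) : Prop :=
  measurable_fun outputs h /\
  exists2 C : R, 0 < C & forall A, measurable A ->
    P A = (C%:E * \int[lebesgue_tuple R r]_(t in A `&` outputs) (h t)%:E)%E.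

(* A mechanism M maps a data set to the distribution of the released output.
   Mechanisms make sense only at a positive scale, so positivity is part of each
   definition.  Here 0 < utility_sens u also rules out a utility of unbounded
   sensitivity, for which the real-valued sup would be 0. *)
Definition exponential_mechanism (u : rvec R r -> X -> R) (eps : R)
    (M : X -> probability (rvec R r) R) : Prop :=
  0 < utility_sens u /\
  forall x, density_prop_to
    (fun t => expR (u t x * eps / (2 * utility_sens u))) (M x).

Definition truncated_gen_gaussian (p : nat) (b : R)
    (M : X -> probability (rvec R r) R) : Prop :=
  0 < b /\
  forall x, density_prop_to
    (fun t => \prod_(k < r) expR (- (`|entry t k - entry (s x) k| / b) ^+ p))
    (M x).

Definition tgg_scale (p : nat) (eps b : R) : Prop :=
  0 < b /\
  2 * eps^-1 * (\sum_(k < r) \sum_(1 <= j < p)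
      'C(p, j)%:R * `|c1 k - c0 k| ^+ (p - j) * sens1_coord k ^+ j
    + sens_lp p ^+ p) <= b ^+ p.

Definition tgg_min_scale (p : nat) (eps b : R) : Prop :=
  tgg_scale p eps b /\ forall b', tgg_scale p eps b' -> b <= b'.

Definition truncated_laplace (b : R)
    (M : X -> probability (rvec R r) R) : Prop :=
  0 < b /\
  forall x, density_prop_to
    (fun t => \prod_(k < r) expR (- `|entry t k - entry (s x) k| / b)) (M x).

End Mechanisms.

(* Main.v *)
(* For p = 1 the triangle inequality bounds the variation of the utility by the
   l1 distance between the two query values, and the output t = s(x') attains
   it; hence the two scales coincide.  For p >= 2 one bounds
   |t_k - s_k(x)|^p - |t_k - s_k(x')|^p coordinatewise: by factoring the
   difference of squares for p = 2, and by expanding (t_k - s_k)^p binomially,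
   where the term t_k^p cancels, for larger p.  The Laplace density can be
   normalized because it lies between two positive constants on a box of finite
   positive volume. *)
From HB Require Import structures.
Require Import Defs.
From mathcomp Require Import all_boot all_order all_algebra.
From mathcomp Require Import all_classical all_reals all_analysis.
From mathcomp Require Import measurable_realfun ring lra.
Import Order.TTheory GRing.Theory Num.Theory.
Local Open Scope ring_scope.

Set Implicit Arguments.
Unset Strict Implicit.

(** * Suprema over pairs of neighbors *)

Section Sensitivity.
Context (R : realType) (X : Type) (nb : X -> X -> Prop).
Implicit Type D : X -> X -> R.

(** Boundedness of [D] is not assumed: a set without a supremum has [sup] equal to 0. *)
Lemma sensitivity_ge0 D : (forall x x', 0 <= D x x') -> 0 <= sensitivity nb D.
Proof.
move=> D0; rewrite /sensitivity; set A := (X in sup X).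
have [hA|/sup_out -> //] := pselect (has_sup A).
have [[v Av] ubA] := hA; apply: le_trans (ub_le_sup ubA Av).
by case: Av => x [x' [_ ->]].
Qed.

(** The value of [B] is immaterial; it only ensures that the real-valued [sup] is a genuine upper
    bound. *)
Lemma le_sensitivity D (B : R) x x' :
  (forall y y', D y y' <= B) -> nb x x' -> D x x' <= sensitivity nb D.
Proof.
move=> DB nbx; apply: ub_le_sup; last by exists x, x'.
by exists B => _ [y [y' [_ ->]]].
Qed.

Lemma sensitivity_le D (B : R) :
  0 <= B -> (forall x x', nb x x' -> D x x' <= B) -> sensitivity nb D <= B.
Proof.
move=> B0 DB; rewrite /sensitivity; set A := (X in sup X).
(* Without neighbors the supremum is 0 by default, hence the assumption [0 <= B]. *)
have [->|/set0P Ane] := eqVneq A set0; first by rewrite sup0.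
by apply: ge_sup => // _ [x [x' [/DB ? ->]]].
Qed.

Lemma utility_sens_le (r : nat) (c0 c1 : 'I_r -> R) (u : rvec R r -> X -> R)
    (B : R) :
  0 <= B ->
  (forall t x x', outputs c0 c1 t -> nb x x' -> `|u t x - u t x'| <= B) ->
  utility_sens nb c0 c1 u <= B.
Proof.
move=> B0 uB; rewrite /utility_sens; set A := (X in sup X).
have [->|/set0P Ane] := eqVneq A set0; first by rewrite sup0.
by apply: ge_sup => // _ [t [x [x' [ot nbx ->]]]]; exact: uB.
Qed.

End Sensitivity.

(** * Powers of the $l_p$ norm and elementary inequalities *)

Lemma lp_norm_exp (R : realType) (r p : nat) (v : 'I_r -> R) : (0 < p)%N ->
  lp_norm p v ^+ p = \sum_(k < r) `|v k| ^+ p.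
Proof.
move=> p0; rewrite -powR_mulrn ?powR_ge0// /lp_norm -powRrM mulVf ?powRr1//.
  by apply: sumr_ge0 => k _; rewrite exprn_ge0.
by rewrite pnatr_eq0 -lt0n.
Qed.

Lemma lp_dist1 (R : realType) (r : nat) (t t' : rvec R r) :
  lp_dist 1 t t' = \sum_(k < r) `|entry t k - entry t' k|.
Proof. by rewrite -[LHS]expr1 lp_norm_exp. Qed.

Lemma lp_utilityE (R : realType) (X : Type) (r p : nat) (s : X -> rvec R r) t x :
  (0 < p)%N ->
  lp_utility s p t x = - \sum_(k < r) `|entry t k - entry (s x) k| ^+ p.
Proof. by move=> p0; rewrite /lp_utility lp_norm_exp. Qed.

Lemma sens_lp1 (R : realType) (X : Type) (nb : X -> X -> Prop) (r : nat)
  (s : X -> rvec R r) : sens_lp nb s 1 = sens1 nb s.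
Proof.
by congr sensitivity; apply/funext => x; apply/funext => x'; exact: lp_dist1.
Qed.

(* Removes the absolute values before the binomial expansion, so that odd [p]
   needs no separate treatment. *)
Lemma dist_normX_le (R : realType) (p : nat) (a b : R) :
  `| `|a| ^+ p - `|b| ^+ p| <= `|a ^+ p - b ^+ p|.
Proof. by rewrite -!normrX ler_dist_dist. Qed.

(** In the two binomial expansions the terms of index 0 are both [t ^+ p] and cancel, so the sum
    starts at 1. *)
Lemma dist_exprB_le (R : realType) (p : nat) (t u v : R) :
  `|(t - u) ^+ p - (t - v) ^+ p| <=
  \sum_(1 <= j < p.+1) 'C(p, j)%:R * `|t| ^+ (p - j) * `|u ^+ j - v ^+ j|.
Proof.
rewrite !exprBn -sumrB big_ord_recl /= !expr0 subrr add0r.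
rewrite big_add1 big_mkord; apply: le_trans (ler_norm_sum _ _ _) _.
apply: ler_sum => i _; rewrite /bump /= add1n -mulrnBl -mulrBr -[X in `|X| <= _]mulr_natl.
by rewrite !normrM normrX normrN1 expr1n mul1r normr_nat normrX mulrA.
Qed.

(** * Bounds on the sensitivity of the utility *)

Section BoundedQuery.
Context (R : realType) (X : Type) (nb : X -> X -> Prop) (r : nat).
Context (c0 c1 : 'I_r -> R) (s : X -> rvec R r).
Hypothesis s_bounded : forall x k, c0 k <= entry (s x) k <= c1 k.

Lemma dist_outputs_le (t t' : rvec R r) k :
  outputs c0 c1 t -> outputs c0 c1 t' -> `|entry t k - entry t' k| <= `|c1 k - c0 k|.
Proof.
move=> /(_ k)/andP[? ?] /(_ k)/andP[? ?].
by rewrite (ger0_norm (_ : 0 <= c1 k - c0 k)) ?ler_norml; lra.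
Qed.

Lemma norm_outputs_le (t : rvec R r) k :
  outputs c0 c1 t -> `|entry t k| <= Num.max `|c0 k| `|c1 k|.
Proof.
move=> /(_ k)/andP[h0 h1]; rewrite le_max.
have [t0|/ltW t0] := leP 0 (entry t k).
  by apply/orP; right; rewrite ger0_norm// (le_trans h1)// ler_norm.
by apply/orP; left; rewrite !ler0_norm ?lerN2// (le_trans h0).
Qed.

Let sO x : outputs c0 c1 (s x) := s_bounded x.

Lemma sens1_coord_ge0 k : 0 <= sens1_coord nb s k.
Proof. exact: sensitivity_ge0. Qed.

Lemma sens1_ge0 : 0 <= sens1 nb s.
Proof. by apply: sensitivity_ge0 => x x'; apply: sumr_ge0. Qed.

Lemma le_sens1_coord x x' k : nb x x' ->
  `|entry (s x) k - entry (s x') k| <= sens1_coord nb s k.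
Proof.
apply: (@le_sensitivity R X nb
  (fun x x' => `|entry (s x) k - entry (s x') k|) `|c1 k - c0 k|) => y y'.
exact: dist_outputs_le.
Qed.

Lemma le_sens1_coord_pow j x x' k : nb x x' ->
  `|entry (s x) k ^+ j - entry (s x') k ^+ j| <= sens1_coord_pow nb s j k.
Proof.
pose m := Num.max `|c0 k| `|c1 k|.
apply: (@le_sensitivity R X nb
  (fun x x' => `|entry (s x) k ^+ j - entry (s x') k ^+ j|)
  (* A crude bound suffices, since it only has to be finite. *)
  (m ^+ j + m ^+ j)) => y y'.
apply: le_trans (ler_normB _ _) _.
have m0 : 0 <= m by rewrite le_max normr_ge0.
by rewrite !normrX lerD// lerXn2r ?nnegrE// norm_outputs_le.
Qed.

Lemma le_sens1 x x' : nb x x' ->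
  \sum_(k < r) `|entry (s x) k - entry (s x') k| <= sens1 nb s.
Proof.
apply: (@le_sensitivity R X nb
  (fun x x' => \sum_(k < r) `|entry (s x) k - entry (s x') k|)
  (\sum_(k < r) `|c1 k - c0 k|)) => y y'.
by apply: ler_sum => k _; exact: dist_outputs_le.
Qed.

(** The reverse triangle inequality in each coordinate makes the bound uniform in [t], even outside
    the output box. *)
Lemma dist_lp_utility1_le (t : rvec R r) x x' : nb x x' ->
  `|lp_utility s 1 t x - lp_utility s 1 t x'| <= sens1 nb s.
Proof.
move=> nbx; apply: le_trans _ (le_sens1 nbx).
rewrite !lp_utilityE// opprK addrC -sumrB.
apply: le_trans (ler_norm_sum _ _ _) (ler_sum _ _) => k _; rewrite !expr1.
apply: le_trans (ler_dist_dist _ _) _.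
by rewrite opprB [X in `|X|](_ : _ = entry (s x) k - entry (s x') k)//; ring.
Qed.

(* Equality is attained at the output [t = s x'], where the utility for [x']
   vanishes. *)
Lemma utility_sens1E : utility_sens nb c0 c1 (lp_utility s 1) = sens1 nb s.
Proof.
apply/eqP; rewrite eq_le; apply/andP; split.
  apply: utility_sens_le => [|t x x' _]; first exact: sens1_ge0.
  exact: dist_lp_utility1_le.
rewrite /utility_sens; set A := (X in _ <= sup X).
have Aub : has_ubound A.
  exists (sens1 nb s) => _ [t [x [x' [_ nbx ->]]]]; exact: dist_lp_utility1_le.
apply: sensitivity_le => [|x x' nbx].
  have [->|/set0P[v Av]] := eqVneq A set0; first by rewrite sup0.
  apply: le_trans (ub_le_sup Aub Av).
  by case: Av => t [x [x' [_ _ ->]]].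
apply: ub_le_sup => //; exists (s x'), x, x'; split=> //.
rewrite !lp_utilityE// opprK addrC [X in X - _]big1 => [|k _]; last first.
  by rewrite subrr normr0.
rewrite sub0r normrN ger0_norm; last by apply: sumr_ge0.
by apply: eq_bigr => k _; rewrite expr1 distrC.
Qed.

Lemma utility_sens2_le : utility_sens nb c0 c1 (lp_utility s 2) <=
  2 * \sum_(k < r) sens1_coord nb s k * `|c1 k - c0 k|.
Proof.
apply: utility_sens_le => [|t x x' tO nbx].
  by rewrite mulr_ge0// sumr_ge0// => k _; rewrite mulr_ge0 ?sens1_coord_ge0.
rewrite !lp_utilityE// opprK addrC -sumrB mulr_sumr.
apply: le_trans (ler_norm_sum _ _ _) (ler_sum _ _) => k _.
rewrite !real_normK ?num_real// [X in `|X|](_ : _ =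
  (entry (s x) k - entry (s x') k) *
  ((entry t k - entry (s x) k) + (entry t k - entry (s x') k))); last by ring.
rewrite normrM mulrCA ler_pM ?le_sens1_coord//.
(* Output and query values lie in the same interval, so each summand is at most its width; this
   gives the factor 2. *)
apply: le_trans (ler_normD _ _) _.
by rewrite mulr_natl mulr2n lerD// dist_outputs_le.
Qed.

(** After the absolute values are dropped, each binomial term is bounded factor by factor: the power
    of [t] by the endpoints, the difference of powers by its sensitivity. *)
Lemma utility_sens_lp_le p : (0 < p)%N ->
  utility_sens nb c0 c1 (lp_utility s p) <=
  \sum_(k < r) \sum_(1 <= j < p.+1)
    'C(p, j)%:R * Num.max `|c0 k| `|c1 k| ^+ (p - j) * sens1_coord_pow nb s j k.
Proof.
move=> p0; have m0 k : 0 <= Num.max `|c0 k| `|c1 k|.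
  by rewrite le_max normr_ge0.
apply: utility_sens_le => [|t x x' tO nbx].
  apply: sumr_ge0 => k _; apply: sumr_ge0 => j _.
  by rewrite !mulr_ge0 ?exprn_ge0 ?sensitivity_ge0.
rewrite !lp_utilityE// opprK addrC -sumrB.
apply: le_trans (ler_norm_sum _ _ _) (ler_sum _ _) => k _.
apply: le_trans (dist_normX_le _ _ _) _; rewrite distrC.
apply: le_trans (dist_exprB_le _ _ _ _) _.
apply: ler_sum => j _; rewrite !ler_pM ?mulr_ge0 ?exprn_ge0//.
  by rewrite lerXn2r ?nnegrE// norm_outputs_le.
exact: le_sens1_coord_pow.
Qed.

End BoundedQuery.

(** * Scales and mechanisms of order 1 *)

Lemma tgg_scale1 (R : realType) (X : Type) (nb : X -> X -> Prop) (r : nat)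
    (c0 c1 : 'I_r -> R) (s : X -> rvec R r) (eps b : R) :
  tgg_scale nb c0 c1 s 1 eps b <-> 0 < b /\ 2 * eps^-1 * sens1 nb s <= b.
Proof.
rewrite /tgg_scale !expr1 sens_lp1 big1 ?add0r// => k _.
(* The range [1 <= j < 1] is empty, so only the $l_1$ sensitivity remains. *)
by rewrite big_geq.
Qed.

Lemma tgg_min_scale1 (R : realType) (X : Type) (nb : X -> X -> Prop) (r : nat)
    (c0 c1 : 'I_r -> R) (s : X -> rvec R r) (eps b : R) : 0 < eps ->
  tgg_min_scale nb c0 c1 s 1 eps b <-> 0 < b /\ b = 2 * eps^-1 * sens1 nb s.
Proof.
move=> eps0; set c := 2 * _ * _.
have c_ge0 : 0 <= c by rewrite /c !mulr_ge0 ?invr_ge0 ?sens1_ge0 ?ltW.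
split=> [[/tgg_scale1[b0 cb] bmin]|[b0 bc]].
  split=> //; apply/eqP; rewrite eq_le cb andbT.
  (* If [c] were 0, every positive scale would be allowed and [b / 2] would undercut the minimum. *)
  have [c_le0|c_gt0] := leP c 0.
    have /bmin : tgg_scale nb c0 c1 s 1 eps (b / 2).
      by apply/tgg_scale1; rewrite -/c; split; lra.
    lra.
  by apply: bmin; apply/tgg_scale1.
split; first by apply/tgg_scale1; rewrite -/c -bc.
by move=> b' /tgg_scale1[_]; rewrite -/c -bc.
Qed.

Lemma tgg1_laplace (R : realType) (X : Type) (r : nat) (c0 c1 : 'I_r -> R)
    (s : X -> rvec R r) (b : R) M :
  truncated_gen_gaussian c0 c1 s 1 b M <-> truncated_laplace c0 c1 s b M.
Proof.
rewrite /truncated_gen_gaussian /truncated_laplace.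
suff E x : (fun t => \prod_(k < r)
      expR (- (`|entry t k - entry (s x) k| / b) ^+ 1)) =
    (fun t => \prod_(k < r) expR (- `|entry t k - entry (s x) k| / b)).
  by split=> -[b0 H]; split=> // x; move: (H x); rewrite E.
by apply/funext => t; apply: eq_bigr => k _; rewrite expr1 mulNr.
Qed.

(** The exponential of the sum splits into a product, and [eps / (2 * D)] is the inverse of the
    Laplace scale. As [eps] is positive, the positivity conditions of the two definitions agree. *)
Lemma exponential1_laplace (R : realType) (X : Type) (nb : X -> X -> Prop)
    (r : nat) (c0 c1 : 'I_r -> R) (s : X -> rvec R r) (eps : R) M :
  let u := lp_utility s 1 in 0 < eps ->
  exponential_mechanism nb c0 c1 u eps M <->
  truncated_laplace c0 c1 s (2 * eps^-1 * utility_sens nb c0 c1 u) M.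
Proof.
move=> u eps0; rewrite /exponential_mechanism /truncated_laplace.
set D := utility_sens _ _ _ _; rewrite pmulr_rgt0 ?mulr_gt0 ?invr_gt0//.
suff E x : (fun t => expR (u t x * eps / (2 * D))) =
    (fun t => \prod_(k < r)
      expR (- `|entry t k - entry (s x) k| / (2 * eps^-1 * D))).
  by split=> -[D0 H]; split=> // x; move: (H x); rewrite E.
apply/funext => t; rewrite -expR_sum -mulr_suml sumrN /u lp_utilityE//.
(* The densities agree even for [D = 0], since the inverse of 0 is 0. *)
congr expR; rewrite !invfM invrK -!mulrA; congr (- _ * _).
by rewrite mulrCA.
Qed.

(** * Normalizing a nonnegative density *)

Section DensityMeasure.
Local Open Scope classical_set_scope.
Context d (T : measurableType d) (R : realType).
Context (mu : {measure set T -> \bar R}) (D : set T) (h : T -> R).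

(** The proofs are arguments so that the measure structure can be attached to the function
    itself. *)
Definition density_measure of measurable D & measurable_fun D h &
    (forall t, 0 <= h t) : set T -> \bar R :=
  fun A => (\int[mu]_(t in A `&` D) (h t)%:E)%E.

Hypotheses (mD : measurable D) (mh : measurable_fun D h).
Hypothesis h0 : forall t, 0 <= h t.

Local Notation nu := (density_measure mD mh h0).

Let nu0 : nu set0 = 0%E.
Proof. by rewrite /density_measure set0I integral_set0. Qed.

Let nu_ge0 A : (0 <= nu A)%E.
Proof. by apply: integral_ge0 => t _; rewrite lee_fin. Qed.

Let nu_sigma_additive : semi_sigma_additive nu.
Proof.
move=> F mF tF mUF; rewrite /density_measure; apply: cvg_toP.
  apply: ereal_nondecreasing_is_cvgn => m n mn.
  by apply: lee_sum_nneg_natr => // k _ _; exact: nu_ge0.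
rewrite setI_bigcupl ge0_integral_bigcup//=.
- by move=> k; exact: measurableI.
- apply/measurable_EFinP; apply: measurable_funS mh => //.
  by move=> t [k _ []].
- by move=> t _; rewrite lee_fin.
- by apply: trivIset_setIr.
Qed.

HB.instance Definition _ := isMeasure.Build _ _ _ nu
  nu0 nu_ge0 nu_sigma_additive.

Lemma density_probability :
  (0 < \int[mu]_(t in D) (h t)%:E)%E ->
  (\int[mu]_(t in D) (h t)%:E < +oo)%E ->
  exists P : probability T R, exists2 C : R, 0 < C & forall A, measurable A ->
    P A = (C%:E * \int[mu]_(t in A `&` D) (h t)%:E)%E.
Proof.
have nuT : nu setT = (\int[mu]_(t in D) (h t)%:E)%E.
  by rewrite /density_measure setTI.
rewrite -nuT => nugt0 nulty.
(* [mnormalize] requires a fallback probability for degenerate total mass; a point of [D] supplies a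
   Dirac measure. *)
have [D0|/set0P[x _]] := eqVneq D set0.
  by move: nugt0; rewrite nuT D0 integral_set0 ltxx.
exists (mnormalize nu \d_x : probability T R), (fine (nu setT))^-1.
  by rewrite invr_gt0 fine_gt0// nugt0.
move=> A mA; rewrite /= /mnormalize gt_eqF ?lt_eqF//=; exact: muleC.
Qed.

End DensityMeasure.

(** * Measurability and volume of boxes *)

Section Boxes.
Local Open Scope classical_set_scope.
Context (R : realType).

Lemma measurable_entry n (k : 'I_n) :
  measurable_fun [set: rvec R n] (fun t : rvec R n => entry t k).
Proof. exact: measurable_tnth. Qed.

Lemma measurable_outputs n (c0 c1 : 'I_n -> R) : measurable (outputs c0 c1).
Proof.
rewrite (_ : outputs c0 c1 =
    \bigcap_(k in [set: 'I_n]) ((@entry R n)^~ k @^-1` `[c0 k, c1 k]%classic)).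
  apply: fin_bigcap_measurable => [|k _]; first exact: finite_finset.
  by rewrite -[X in measurable X]setTI; exact: measurable_entry.
apply/seteqP; split=> t /= tO k; first by rewrite /= in_itv/=.
by have := tO k I; rewrite /= in_itv.
Qed.

(** By induction: pulled back along [cons_rvec], the box is its first interval times a box of one
    dimension less. *)
Lemma lebesgue_tuple_outputs n (c0 c1 : 'I_n -> R) :
  (forall k, c0 k < c1 k) ->
  lebesgue_tuple R n (outputs c0 c1) = (\prod_(k < n) (c1 k - c0 k))%:E.
Proof.
elim: n c0 c1 => [|n IH] c0 c1 c01.
  (* In dimension 0 the box holds the empty tuple, with Dirac mass 1, the empty product. *)
  by rewrite big_ord0 /= diracE mem_set// => -[].
rewrite big_ord_recl /= /lebesgue_step /pushforward.
rewrite (_ : _ @^-1` _ = `[c0 ord0, c1 ord0]%classic `*`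
    outputs (fun k => c0 (lift ord0 k)) (fun k => c1 (lift ord0 k))).
  rewrite product_measure1E; last 2 first.
  - exact: measurable_itv.
  - exact: measurable_outputs.
  rewrite IH// EFinM; congr (_ * _)%E.
  by apply: etrans (lebesgue_measure_itv _) _; rewrite /= lte_fin c01.
apply/seteqP; split=> -[x t] /=.
  move=> xtO; split; first by have := xtO ord0; rewrite in_itv.
  by move=> k; have := xtO (lift ord0 k); rewrite /entry /cons_rvec tnthS.
rewrite in_itv/= => -[xO tO] k; rewrite /entry /cons_rvec.
by have [j ->|->] := unliftP ord0 k; [rewrite tnthS; exact: tO|].
Qed.

End Boxes.

(** * Existence of the truncated Laplace distribution *)

Section TruncatedLaplace.
Context (R : realType) (r : nat) (c0 c1 : 'I_r -> R) (b : R) (a : rvec R r).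

Local Notation h := (fun t : rvec R r =>
  \prod_(k < r) expR (- `|entry t k - entry a k| / b)).

Lemma measurable_laplace D : measurable_fun D h.
Proof.
apply: measurable_funTS; apply: measurable_prod => k _.
apply: measurableT_comp => //; apply: measurable_funM => //.
apply: measurableT_comp => //; apply: measurableT_comp => //.
by apply: measurable_funB => //; exact: measurable_entry.
Qed.

Lemma truncated_laplace_probability : 0 < b -> (forall k, c0 k < c1 k) ->
  outputs c0 c1 a -> exists P, density_prop_to c0 c1 h P.
Proof.
move=> b0 c01 aO; pose V := \prod_(k < r) (c1 k - c0 k).
have V0 : 0 < V by apply: prodr_gt0 => k _; rewrite subr_gt0.
have muO : (lebesgue_tuple R r : {measure set (rvec R r) -> \bar R})
    (outputs c0 c1) = V%:E := lebesgue_tuple_outputs c01.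
have mO := measurable_outputs c0 c1.
have mh := @measurable_laplace (outputs c0 c1).
have h0 t : 0 <= h t by apply: prodr_ge0 => k _; exact: expR_ge0.
have [||P [C C0 PE]] := density_probability (mu := lebesgue_tuple R r) mO mh h0.
(* [m] is the value of the density if every coordinate deviated by the full width; it bounds the
   density below on the box, so the mass is positive. *)
- pose m := \prod_(k < r) expR (- `|c1 k - c0 k| / b).
  apply: (@lt_le_trans _ _ (\int[lebesgue_tuple R r]_(t in outputs c0 c1)
      (cst m%:E t))%E).
    rewrite integral_cst// muO -EFinM lte_fin mulr_gt0//.
    by apply: prodr_gt0 => k _; exact: expR_gt0.
  apply: ge0_le_integral => //.
  + by move=> t _; rewrite lee_fin prodr_ge0// => k _; exact: expR_ge0.
  + exact/measurable_EFinP.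
  move=> t tO; rewrite lee_fin; apply: ler_prod => k _.
  by rewrite expR_ge0 ler_expR ler_pM2r ?invr_gt0// lerN2 dist_outputs_le.
(* Each factor is at most 1, so the mass is at most the volume of the box. *)
- apply: (@le_lt_trans _ _ (\int[lebesgue_tuple R r]_(t in outputs c0 c1)
      (cst 1%:E t))%E); last by rewrite integral_cst// muO mul1e ltry.
  apply: ge0_le_integral => //.
  + by move=> t _; rewrite lee_fin.
  + exact/measurable_EFinP.
  move=> t _; rewrite lee_fin; apply: prodr_ile1 => k _.
  by rewrite expR_ge0 -expR0 ler_expR mulNr oppr_le0 divr_ge0// ltW.
by exists P; split=> //; exists C.
Qed.

End TruncatedLaplace.

Unset Implicit Arguments.
Set Strict Implicit.

Theorem lemma9 (R : realType) (X : Type) (nb : X -> X -> Prop)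
    (nb_sym : forall x x' : X, nb x x' -> nb x' x)
    (r : nat) (c0 c1 : 'I_r -> R) (s : X -> rvec R r)
    (s_bounded : forall (x : X) (k : 'I_r), c0 k <= entry (s x) k <= c1 k) :
  (utility_sens nb c0 c1 (lp_utility s 1) <= sens1 nb s
   /\ forall eps : R, 0 < eps ->
      let b := 2 * eps^-1 * sens1 nb s in
      [/\ 2 * eps^-1 * utility_sens nb c0 c1 (lp_utility s 1) = b,
          (0 < b -> tgg_min_scale nb c0 c1 s 1 eps b),
          (forall M : X -> probability (rvec R r) R,
             (exists2 b1 : R, tgg_min_scale nb c0 c1 s 1 eps b1
                & truncated_gen_gaussian c0 c1 s 1 b1 M)
             <-> truncated_laplace c0 c1 s b M),
          (forall M : X -> probability (rvec R r) R,
             exponential_mechanism nb c0 c1 (lp_utility s 1) eps M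
             <-> truncated_laplace c0 c1 s b M)
        & (0 < b -> (forall k : 'I_r, c0 k < c1 k) ->
           exists M : X -> probability (rvec R r) R,
             truncated_laplace c0 c1 s b M)])
  /\ utility_sens nb c0 c1 (lp_utility s 2)
       <= 2 * \sum_(k < r) sens1_coord nb s k * `|c1 k - c0 k|
  /\ (forall p : nat, (3 <= p)%N ->
      utility_sens nb c0 c1 (lp_utility s p)
        <= \sum_(k < r) \sum_(1 <= j < p.+1)
             'C(p, j)%:R * Num.max `|c0 k| `|c1 k| ^+ (p - j)
               * sens1_coord_pow nb s j k).
Proof.
split; last split.
- split=> [|eps eps0 b]; first by rewrite utility_sens1E.
  split.
  + by rewrite utility_sens1E.
  + by move=> b0; apply/tgg_min_scale1.
  + move=> M; split=> [[b1 /tgg_min_scale1[//|_ ->] /tgg1_laplace //]|LM].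
    (* Positivity of [b], needed for a smallest scale to exist, is contained in the definition of
       the Laplace mechanism. *)
    have [b0 _] := LM.
    by exists b; [apply/tgg_min_scale1|apply/tgg1_laplace].
  + by move=> M; rewrite /b -(utility_sens1E nb s_bounded) exponential1_laplace.
  + move=> b0 c01.
    have /choice[M HM] := fun x => truncated_laplace_probability
      b0 c01 (s_bounded x).
    by exists M.
- exact: utility_sens2_le.
- by move=> p p3; apply: utility_sens_lp_le => //; exact: leq_trans p3.
Qed.
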